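(* Let $d\ge1$ and $\beta>0$. Let the couplings $J=(J_b)_b$ be IID real random variables with a continuous distribution, and assume that $0$ is in the support of the distribution of $J_b$. Let $\varepsilon,\varepsilon'$ and $\langle\cdot\rangle_t$ be as described in the context. Then there is a constant $\delta'>0$, depending on the distribution of the couplings (and on $\beta$, $d$) but not on $\Lambda$, $\delta$ or $t$, and for every box $\Lambda$ (and every boundary condition) an event $A=A_\Lambda$, not depending on $\delta$ or $t$, with $\mathbb{P}(A_\Lambda)>0$ uniformly in $\Lambda$ (i.e. $\mathbb{P}(A_\Lambda)\ge c$ for a constant $c>0$ not depending on $\Lambda$), such that the following holds. For any $\delta>0$ there exists $t_0=t_0(\delta)>0$, not depending on $\Lambda$, such that $$\mathbb{E}\big[\langle Q_\Lambda(\sigma,\sigma')\rangle_t\big]>(1-\delta)\,\delta'\,\mathbb{P}(A)\qquad\text{for all }0\le t<t_0(\delta).$$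
   Context: A box $\Lambda\subset\mathbb{Z}^d$ is a translate of $\{1,\dots,n\}^d$ with $n\ge 2$. Its exterior vertex boundary $\partial\Lambda$ is the set of vertices of $\mathbb{Z}^d\setminus\Lambda$ with a nearest neighbor in $\Lambda$. For a finite vertex set $V$, $V^*$ denotes the set of nearest-neighbor edges of $\mathbb{Z}^d$ with both endpoints in $V$. A boundary condition is a fixed assignment of values $s_x\in\{-1,+1\}$ for $x\in\partial\Lambda$. For $J\in\mathbb{R}^{(\Lambda\cup\partial\Lambda)^*}$ and $s\in\{-1,+1\}^\Lambda$ (extended to $\partial\Lambda$ by the boundary condition), the Edwards-Anderson Hamiltonian is $$H_{\Lambda,J}(s)=\sum_{\{x,y\}\in(\Lambda\cup\partial\Lambda)^*}-J_{xy}s_xs_y .$$ The overlap is $Q_\Lambda(\sigma,\sigma')=\frac{1}{|\Lambda^*|}\sum_{\{x,y\}\in\Lambda^*}\sigma_x\sigma_y\sigma'_x\sigma'_y$. Under $\mathbb{P}$ (with expectation $\mathbb{E}$), the couplings $(J_b)_{b\in(\Lambda\cup\partial\Lambda)^*}$ are IID with a continuous (atomless) law that does not depend on $\Lambda$ (no symmetry is assumed). The perturbations $\varepsilon=(\varepsilon_b)_b$ and $\varepsilon'=(\varepsilon'_b)_b$, indexed by $b\in(\Lambda\cup\partial\Lambda)^*$, are independent of each other and of $J$, and all their entries are IID with a fixed continuous distribution of mean $0$ (not depending on $\Lambda$). For fixed realizations of $J,\varepsilon,\varepsilon'$, $\langle\cdot\rangle_t$ denotes expectation over a pair $(\sigma,\sigma')$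 of independent random configurations in $\{-1,+1\}^\Lambda$, where $\sigma$ has probability proportional to $e^{-\beta H_{\Lambda,J+t\varepsilon}(\sigma)}$ and $\sigma'$ has probability proportional to $e^{-\beta H_{\Lambda,J+t\varepsilon'}(\sigma')}$. *)

(* Defs.v *)
From HB Require Import structures.
From mathcomp Require Import all_boot all_order all_algebra finmap.
From mathcomp Require Import all_classical all_reals all_analysis.

Set Implicit Arguments.
Unset Strict Implicit.
Unset Printing Implicit Defensive.

Import Order.TTheory GRing.Theory Num.Theory.
Import numFieldNormedType.Exports.

Local Open Scope classical_set_scope.
Local Open Scope ring_scope.

Definition vertex (d : nat) := 'rV[int]_d.

Definition neighbors (d : nat) (x : vertex d) : {fset vertex d} :=
  ([fset (x + delta_mx 0 i : vertex d)%R | i : 'I_d] `|`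
   [fset (x - delta_mx 0 i : vertex d)%R | i : 'I_d])%fset.

(* The translate by [a] of {1, ..., n}^d; [k i] ranges over {0, ..., n - 1}. *)
Definition box_point (d : nat) (a : vertex d) (n : nat)
    (k : {ffun 'I_d -> 'I_n}) : vertex d :=
  \row_i (a 0 i + (k i).+1%:Z).

Definition box (d : nat) (a : vertex d) (n : nat) : {fset vertex d} :=
  [fset box_point a k | k : {ffun 'I_d -> 'I_n}]%fset.

Definition boundary (d : nat) (L : {fset vertex d}) : {fset vertex d} :=
  [fset y in \bigcup_(x <- L) neighbors x | y \notin L]%fset.

Definition closed_box (d : nat) (L : {fset vertex d}) : {fset vertex d} :=
  (L `|` boundary L)%fset.

(* V^*: an unordered edge is represented by the set of its two endpoints. *)
Definition edges (d : nat) (V : {fset vertex d}) : {fset {fset vertex d}} :=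
  [fset [fset x; y] | x in V, y in V & y \in neighbors x]%fset.

Section EdwardsAnderson.
Variables (R : realType) (d : nat) (L : {fset vertex d}).

Definition spin (b : bool) : R := if b then 1 else -1.

Definition config := {ffun L -> bool}.
Definition bcond := {ffun boundary L -> bool}.
Definition couplings := edges (closed_box L) -> R.

(* The value outside the union of [L] and its boundary is never used. *)
Definition extend (eta : bcond) (s : config) (x : vertex d) : R :=
  match insub x : option L, insub x : option (boundary L) with
  | Some u, _ => spin (s u)
  | None, Some v => spin (eta v)
  | None, None => 1
  end.

Definition hamiltonian (eta : bcond) (J : couplings) (s : config) : R :=
  \sum_(b : edges (closed_box L)) - J b * \prod_(x <- val b) extend eta s x.

Definition partition_function (beta : R) (eta : bcond) (J : couplings) : R :=
  \sum_(s : config) expR (- beta * hamiltonian eta J s).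

Definition gibbs (beta : R) (eta : bcond) (J : couplings) (s : config) : R :=
  expR (- beta * hamiltonian eta J s) / partition_function beta eta J.

(* The endpoints of an edge of [edges L] are elements of [L]. *)
Definition overlap (s s' : config) : R :=
  (#|` edges L|%:R)^-1 *
  \sum_(b <- edges L)
    \prod_(x : L | val x \in b) (spin (s x) * spin (s' x)).

Definition mean_overlap (beta : R) (eta : bcond) (J J' : couplings) : R :=
  \sum_(s : config) \sum_(s' : config)
    gibbs beta eta J s * gibbs beta eta J' s' * overlap s s'.

End EdwardsAnderson.

Section Laws.
Variable R : realType.
Implicit Types mu : probability (measurableTypeR R) R.

Definition atomless mu := forall x : R, mu [set x] = 0%E.

Definition law_support mu : set R :=
  [set x | forall U : set R, open U -> U x -> (0 < mu U)%E].

Definition centered mu :=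
  mu.-integrable setT EFin /\ (\int[mu]_x x%:E = 0)%E.

Definition has_law (dO : measure_display) (Omega : measurableType dO)
    (P : probability Omega R) (X : {RV P >-> measurableTypeR R}) mu :=
  forall B : set (measurableTypeR R), measurable B -> distribution P X B = mu B.

Definition mutually_independent (dO : measure_display)
    (Omega : measurableType dO) (P : probability Omega R) (I : finType)
    (X : I -> {RV P >-> measurableTypeR R}) :=
  forall (D : {set I}) (B : I -> set (measurableTypeR R)),
    (forall i, measurable (B i)) ->
    (P (\bigcap_(i in [set` D]) (X i @^-1` B i)) =
     \prod_(i in D) P (X i @^-1` B i))%E.

Definition disorder (dO : measure_display) (Omega : measurableType dO)
    (P : probability Omega R) (E : finType) mu nu
    (J eps eps' : E -> {RV P >-> measurableTypeR R}) :=
  [/\ forall b, has_law (J b) mu,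
      forall b, has_law (eps b) nu,
      forall b, has_law (eps' b) nu
    & mutually_independent (fun i : E + E + E =>
        match i with
        | inl (inl b) => J b
        | inl (inr b) => eps b
        | inr b => eps' b
        end)].

End Laws.

(* Main.v *)
(** Given the couplings, the two replicas are independent with the same law, so
    the contribution of an edge [b = {x, y}] to the expected overlap is the
    second moment of [G(J)], the mean of [<s_x s_y>] over the perturbation.
    As a function of [J_b] alone, [<s_x s_y>] is a logistic function of
    [J_b + const], hence monotone. Flipping the spin at [x] shows that the
    constant is bounded in terms of the at most [2d] couplings at [x] only, so
    when these are bounded, which has probability at least [2^-2d], [G] grows
    by a fixed amount between two levels [u < v]; hence [|G|] is bounded below
    on [J_b <= u] or on [J_b >= v], and both events have positive probability.
    The perturbations enter only through those at [x], which makes every bound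
    independent of the box; the event [A] can be the whole sample space. *)
Require Import Defs.
From HB Require Import structures.
From mathcomp Require Import all_boot all_order all_algebra finmap.
From mathcomp Require Import all_classical all_reals all_analysis.
From mathcomp Require Import measurable_realfun ring lra.
Import Order.TTheory GRing.Theory Num.Theory.
Import numFieldNormedType.Exports.
Local Open Scope classical_set_scope.
Local Open Scope ring_scope.

Set Implicit Arguments.
Unset Strict Implicit.
Unset Printing Implicit Defensive.

(** * Gibbs means on a finite state space as functions of one coupling *)

Definition update (E : eqType) (T : Type) (J : E -> T) (b : E) (u : T) : E -> T :=
  fun e => if e == b then u else J e.

Section FiniteGibbs.
Variables (R : realType) (S E : finType) (beta : R) (chi : E -> S -> R).
Implicit Types (J : E -> R) (s : S) (K u v : R).

(** In the application [chi e] is the product of the spins over the edge [e]; the sign in the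
    exponent is positive because the Hamiltonian carries a minus. *)
Definition weight J s : R := expR (beta * \sum_e J e * chi e s).

Definition mean J (f : S -> R) : R :=
  (\sum_s f s * weight J s) / \sum_s weight J s.

Lemma weight_gt0 J s : 0 < weight J s. Proof. exact: expR_gt0. Qed.

Lemma sum_weight_gt0 J s : 0 < \sum_s weight J s.
Proof.
rewrite (bigD1 s)//= ltr_pwDl ?weight_gt0// sumr_ge0// => i _.
exact/ltW/weight_gt0.
Qed.

Lemma mean_normr_le1 J f : (forall s, `|f s| <= 1) -> `|mean J f| <= 1.
Proof.
(* Without states both sums are empty and the mean is 0 / 0 = 0. *)
move=> f1; rewrite /mean; case: (pickP [pred s : S | true]) => [s _|S0]; last first.
  by rewrite !big_pred0 ?mul0r ?normr0 ?ler01 // => s; move: (S0 s).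
rewrite normrM normfV (ger0_norm (ltW (sum_weight_gt0 J s))).
rewrite ler_pdivrMr ?(sum_weight_gt0 J s)// mul1r.
apply: le_trans (ler_norm_sum _ _ _) _; apply: ler_sum => i _.
by rewrite normrM (gtr0_norm (weight_gt0 J i)) ler_piMl// ltW// weight_gt0.
Qed.

Variable b : E.
Hypothesis chi_b : forall s, (chi b s == 1) || (chi b s == -1).

Definition off_energy J s : R := \sum_(e | e != b) J e * chi e s.

(** Half of the partition function without the term of [b]: all that the other couplings contribute
    to the mean of [chi b] is the ratio of the halves at 1 and at -1. *)
Definition half_sum J (x : R) : R :=
  \sum_(s | chi b s == x) expR (beta * off_energy J s).

Lemma half_sum_ge0 J x : 0 <= half_sum J x.
Proof. by apply: sumr_ge0 => s _; exact: expR_ge0. Qed.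

Lemma eq_half_sum J J' x : (forall e, e != b -> J e = J' e) ->
  half_sum J x = half_sum J' x.
Proof.
move=> JJ'; apply: eq_bigr => s _; congr (expR (_ * _)).
by apply: eq_bigr => e /JJ' ->.
Qed.

(** Taking [f] constant 1 gives the partition function, taking the identity gives the numerator of
    the mean of [chi b]. *)
Lemma sum_weight_halves J (f : R -> R) :
  \sum_s f (chi b s) * weight J s =
  f 1 * (expR (beta * J b) * half_sum J 1) +
  f (-1) * (expR (- (beta * J b)) * half_sum J (-1)).
Proof.
have wE s : weight J s = expR (beta * J b * chi b s) * expR (beta * off_energy J s).
  by rewrite /weight (bigD1 b)//= mulrDr expRD mulrA.
rewrite (bigID (fun s => chi b s == 1))/=; congr (_ + _).
  rewrite !mulr_sumr; apply: eq_bigr => s /eqP cs.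
  by rewrite wE cs mulr1.
rewrite !mulr_sumr; apply: eq_big => [s|s].
  case/orP: (chi_b s) => /eqP ->; last by rewrite eqxx; apply/eqP => /eqP;
    rewrite eqNr oner_eq0.
  by rewrite eqxx/=; apply/esym/eqP => /eqP; rewrite eq_sym eqNr oner_eq0.
move=> cs; have /eqP {}cs : chi b s == -1 by move: (chi_b s); rewrite (negbTE cs).
by rewrite wE cs mulrN1.
Qed.

Lemma mean_halves J : 0 < half_sum J (-1) ->
  mean J (chi b) =
  1 - 2 / (1 + expR (2 * beta * J b) * (half_sum J 1 / half_sum J (-1))).
Proof.
move=> Zm; have := sum_weight_halves J (fun=> 1); under eq_bigr do rewrite mul1r.
rewrite /mean (sum_weight_halves J id) => ->; rewrite !mul1r mulN1r.
have -> : 2 * beta * J b = beta * J b + beta * J b by ring.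
rewrite expRD expRN.
have := half_sum_ge0 J 1; have := expR_gt0 (beta * J b).
move: (expR _) (half_sum J 1) (half_sum J (-1)) Zm => x p m m0 x0 p0.
have h : 0 < x * x * p + m by rewrite ltr_wpDl// !mulr_ge0// ltW.
field; do ?[apply/andP; split]; rewrite ?gt_eqF//.
by rewrite addrC.
Qed.

Variables (flip : S -> S) (D : {set E}).
Hypothesis flipK : involutive flip.
Hypothesis chi_flip : forall e s,
  chi e (flip s) = if e \in D then - chi e s else chi e s.
Hypothesis bD : b \in D.
Hypothesis chi_le1 : forall e s, `|chi e s| <= 1.
Variable m : nat.
Hypothesis Dm : (#|D| <= m)%N.

(** Only terms with [e] in [D] change under the flip, each by at most [2 * K], and there are at most
    [m] of them, whatever the size of [E]. *)
Lemma off_energy_flip J K s : (forall e, e \in D -> e != b -> `|J e| <= K) ->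
  0 <= K -> off_energy J (flip s) <= off_energy J s + 2 * K *+ m.
Proof.
move=> JK K0; rewrite -lerBlDl /off_energy -sumrB.
apply: (@le_trans _ _ (\sum_(e in D) 2 * K)); last first.
  by rewrite sumr_const ler_wpMn2l// mulr_ge0.
rewrite [leRHS]big_mkcond [leLHS]big_mkcond/=; apply: ler_sum => e _.
rewrite chi_flip; case: ifPn => eb; case: ifPn => eD; rewrite ?subrr ?mulr_ge0//.
have -> : J e * - chi e s - J e * chi e s = - (2 * (J e * chi e s)) by ring.
apply: le_trans (ler_norm _) _; rewrite normrN normrM ger0_norm// ler_pM2l// normrM.
by apply: le_trans (JK _ eD eb); rewrite ler_piMr.
Qed.

(** The flip is a bijection between the states with [chi b] equal to [x] and those with [- x], so
    the two halves differ at most by the energy cost of a flip. *)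
Lemma half_sum_flip J K x : 0 <= beta ->
  (forall e, e \in D -> e != b -> `|J e| <= K) -> 0 <= K ->
  half_sum J (- x) <= expR (beta * (2 * K *+ m)) * half_sum J x.
Proof.
move=> b0 JK K0; rewrite /half_sum (reindex_inj (inv_inj flipK))/= mulr_sumr.
under eq_bigl do rewrite chi_flip bD eqr_opp.
apply: ler_sum => s _; rewrite -expRD ler_expR -mulrDr ler_wpM2l// addrC.
exact: off_energy_flip.
Qed.

Lemma half_sum_gt0 J (s : S) x : x ^+ 2 = 1 -> 0 < half_sum J x.
Proof.
move=> x2.
have [s' cs'] : exists s', chi b s' == x.
  move: x2 => /eqP; rewrite sqrf_eq1 => /orP[]/eqP ->.
    case/orP: (chi_b s) => [?|/eqP cs]; first by exists s.
    by exists (flip s); rewrite chi_flip bD cs opprK.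
  case/orP: (chi_b s) => [/eqP cs|?]; last by exists s.
  by exists (flip s); rewrite chi_flip bD cs.
by rewrite /half_sum (bigD1 s')//= ltr_pwDl ?expR_gt0// sumr_ge0.
Qed.

(** The Gibbs probability of [chi b = 1] divided by that of [chi b = -1]. *)
Definition odds J : R :=
  expR (2 * beta * J b) * (half_sum J 1 / half_sum J (-1)).

Lemma odds_gt0 J (s : S) : 0 < odds J.
Proof.
by rewrite /odds mulr_gt0 ?expR_gt0// divr_gt0// half_sum_gt0// ?expr1n// sqrrN expr1n.
Qed.

Lemma odds_update J u v :
  odds (update J b v) = expR (2 * beta * (v - u)) * odds (update J b u).
Proof.
rewrite /odds /update !eqxx [RHS]mulrA -expRD; congr (expR _ * (_ / _)); first by ring.
all: by apply: eq_half_sum => e /negPf ->.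
Qed.

Lemma meanE_odds J (s : S) : mean J (chi b) = 1 - 2 / (1 + odds J).
Proof. by rewrite mean_halves// half_sum_gt0// sqrrN expr1n. Qed.

(** Raising the coupling at [b] multiplies the odds by a factor at least 1, and the mean is an
    increasing function of the odds. *)
Lemma mean_update_le J u v : 0 <= beta -> u <= v ->
  mean (update J b u) (chi b) <= mean (update J b v) (chi b).
Proof.
move=> b0 uv; case: (pickP [pred s : S | true]) => [s _|S0]; last first.
  by rewrite /mean !big_pred0 ?mul0r // => s; move: (S0 s).
rewrite !(meanE_odds _ s) lerD2l lerN2 ler_pM2l//.
have pos J' : 0 < 1 + odds J' by rewrite addr_gt0// (odds_gt0 _ s).
rewrite lef_pV2 ?posrE ?pos// lerD2l (odds_update J u v) ler_peMl ?(ltW (odds_gt0 _ s))//.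
by rewrite -[leLHS]expR0 ler_expR !mulr_ge0 ?subr_ge0.
Qed.

(** The first term of the exponent accounts for the coupling at [b] itself, the second for the
    energy cost of a flip. *)
Definition odds_max K : R :=
  expR (2 * beta * K + beta * (2 * K *+ m)).

(* For odds [x] and [y = g * x], both in [W^-1, W], the two means differ by
   [2 * (g - 1) * x / ((1 + x) * (1 + y))]. *)
Definition mean_gap K (delta : R) : R :=
  2 * (expR (2 * beta * delta) - 1) / (odds_max K * (1 + odds_max K) ^+ 2).

Lemma odds_bounds J K (s : S) : 0 <= beta -> 0 <= K ->
  (forall e, e \in D -> `|J e| <= K) ->
  (odds_max K)^-1 <= odds J <= odds_max K.
Proof.
move=> b0 K0 JK.
have JK' e : e \in D -> e != b -> `|J e| <= K by move=> /JK.
have Wp := half_sum_gt0 J s (expr1n _ 2).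
have Wm : 0 < half_sum J (-1) by apply: half_sum_gt0 => //; rewrite sqrrN expr1n.
have := JK _ bD; rewrite ler_norml => /andP[Kb1 Kb2].
have bb : 0 <= 2 * beta by rewrite mulr_ge0.
rewrite /odds /odds_max expRD; apply/andP; split.
  rewrite invfM ler_pM ?invr_ge0 ?expR_ge0//.
    by rewrite -expRN ler_expR -mulrN ler_wpM2l.
  rewrite ler_pdivlMr// mulrC ler_pdivrMr ?expR_gt0// mulrC.
  exact: half_sum_flip.
rewrite ler_pM ?expR_ge0 ?divr_ge0 ?(ltW Wp) ?(ltW Wm)//.
  by rewrite ler_expR ler_wpM2l.
(* The upper bound uses the flip in the other direction, from -1 to 1 = -(-1). *)
rewrite ler_pdivrMr// -[X in half_sum _ X <= _](opprK 1).
exact: half_sum_flip.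
Qed.

Lemma mean_update_gap J K u v (s : S) : 0 <= beta -> 0 <= K -> u <= v ->
  (forall e, e \in D -> e != b -> `|J e| <= K) -> `|u| <= K -> `|v| <= K ->
  mean_gap K (v - u) <=
  mean (update J b v) (chi b) - mean (update J b u) (chi b).
Proof.
move=> b0 K0 uv JK uK vK.
have bd w : `|w| <= K -> forall e, e \in D -> `|update J b w e| <= K.
  by move=> wK e eD; rewrite /update; case: ifPn => // eb; exact: JK.
have /andP[u1 u2] := odds_bounds s b0 K0 (bd u uK).
have /andP[v1 v2] := odds_bounds s b0 K0 (bd v vK).
rewrite !(meanE_odds _ s) /mean_gap.
have := odds_update J u v.
have : 1 <= expR (2 * beta * (v - u)) by rewrite -[leLHS]expR0 ler_expR !mulr_ge0 ?subr_ge0.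
set W := odds_max _ in u1 u2 v1 v2 *.
move: (expR (_ * (_ - _))) => g g1.
have W0 : 0 < W by exact: expR_gt0.
have ou := odds_gt0 (update J b u) s; have ov := odds_gt0 (update J b v) s.
move: W W0 (odds (update J b u)) (odds (update J b v)) ou ov u1 u2 v1 v2.
move=> W W0 x y x0 y0 x1 x2 y1 y2 yE.
have -> : 1 - 2 / (1 + y) - (1 - 2 / (1 + x)) = 2 * (g - 1) * (x / ((1 + x) * (1 + y))).
  by rewrite yE; field; rewrite -yE !gt_eqF// addr_gt0.
rewrite ler_wpM2l ?mulr_ge0 ?subr_ge0//.
(* The numerator [x] is at least [W^-1], and both factors of the denominator are at most [1 + W]. *)
rewrite invfM ler_pM ?invr_ge0 ?(ltW W0) ?exprn_ge0 ?addr_ge0// ?(ltW W0)//.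
rewrite lef_pV2 ?posrE ?mulr_gt0 ?exprn_gt0 ?addr_gt0//.
by rewrite expr2 ler_pM ?addr_ge0 ?(ltW x0) ?(ltW y0)// lerD2l.
Qed.

Lemma mean_gap_gt0 K delta : 0 < beta -> 0 < delta -> 0 < mean_gap K delta.
Proof.
move=> b0 d0; rewrite /mean_gap divr_gt0//.
  by rewrite mulr_gt0// subr_gt0 expR_gt1 !mulr_gt0.
have W0 : 0 < odds_max K by exact: expR_gt0.
by rewrite mulr_gt0// exprn_gt0// addr_gt0.
Qed.

End FiniteGibbs.

(** * The product sigma-algebra on finite families of reals *)

(** Every coordinate is constrained at once; as [I] is finite, these rectangles are measurable,
    stable under intersection, and generate the product sigma-algebra. *)
Definition cylinders (R : realType) (I : finType) : set (set (I -> R)) :=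
  [set [set x | forall i, B i (x i)] |
    B in [set B : I -> set R | forall i, measurable (B i)]].

Notation product_space R I := (g_sigma_algebraType (@cylinders R I)).

Section CylinderSigmaAlgebra.
Variables (R : realType) (I : finType).

Lemma measurable_coordinate (i : I) :
  measurable_fun [set: product_space R I] (fun x : product_space R I => x i).
Proof.
move=> _ B mB; rewrite setTI; apply: sub_sigma_algebra.
exists (fun j => if j == i then B else setT).
  by move=> j; case: ifP.
apply/seteqP; split => [x /(_ i)/=|x /= Bx j]; first by rewrite eqxx.
by case: eqP => // ->.
Qed.

Lemma measurable_forall (d : measure_display) (T : measurableType d)
    (X : I -> T -> R) (B : I -> set R) :
  (forall i, measurable_fun setT (X i)) -> (forall i, measurable (B i)) ->
  measurable [set w | forall i, B i (X i w)].
Proof.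
move=> mX mB.
rewrite (_ : [set w | _] = \bigcap_(i in setT) (X i @^-1` B i)); last first.
  by apply/seteqP; split => w /= Bw i; [move=> _|]; exact: Bw.
apply: fin_bigcap_measurable => [|i _]; first exact: finite_finset.
by rewrite -[X in measurable X]setTI; exact: mX.
Qed.

Lemma measurable_tofun (d : measure_display) (T : measurableType d)
    (X : I -> T -> R) : (forall i, measurable_fun setT (X i)) ->
  measurable_fun setT (fun w => (fun i => X i w) : product_space R I).
Proof.
move=> mX; apply: measurability => // _ [_ [B mB <-] <-]; rewrite setTI.
exact: measurable_forall.
Qed.

Lemma setI_closed_cylinders : setI_closed (@cylinders R I).
Proof.
move=> _ _ [B mB <-] [C mC <-]; exists (fun i => B i `&` C i).
  by move=> i; exact: measurableI.
by apply/seteqP; split => [x BC|x [Bx Cx] i]; [split=> i; case: (BC i)|split].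
Qed.

Lemma integrable_bounded (d : measure_display) (T : measurableType d)
    (P : probability T R) (f : T -> R) (M : R) :
  measurable_fun setT f -> (forall w, `|f w| <= M) ->
  P.-integrable setT (EFin \o f).
Proof.
move=> mf fM; apply: measurable_bounded_integrable => //.
  by rewrite (le_lt_trans (probability_le1 P _))// ltry.
by exists M; split; [exact: num_real|move=> N MN w _; exact: le_trans (fM w) (ltW MN)].
Qed.

(** The joint laws of [X] and [Y] agree on a class that is stable under intersection and generates
    the sigma-algebra, hence they are equal; both integrals are then integrals of [F] against this
    common law. *)
Lemma eq_cylinder_integral (d d' : measure_display) (T : measurableType d)
    (T' : measurableType d') (P : probability T R) (P' : probability T' R)
    (X : I -> T -> R) (Y : I -> T' -> R) (F : (I -> R) -> R) (M : R) :
  (forall i, measurable_fun setT (X i)) ->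
  (forall i, measurable_fun setT (Y i)) ->
  (forall B : I -> set R, (forall i, measurable (B i)) ->
    P [set w | forall i, B i (X i w)] = P' [set w | forall i, B i (Y i w)]) ->
  measurable_fun [set: product_space R I] F -> (forall x, `|F x| <= M) ->
  (\int[P]_w (F (X^~ w))%:E = \int[P']_w (F (Y^~ w))%:E)%E.
Proof.
move=> mX mY PXY mF FM.
pose phi w : product_space R I := X^~ w; pose psi w : product_space R I := Y^~ w.
have mphi : measurable_fun setT phi by exact: measurable_tofun.
have mpsi : measurable_fun setT psi by exact: measurable_tofun.
pose G (x : product_space R I) := (F x)%:E.
have mG : measurable_fun [set: product_space R I] G by exact/measurable_EFinP.
have iX : P.-integrable (phi @^-1` setT) (G \o phi).
  exact: (integrable_bounded P (measurableT_comp mF mphi) (fun w => FM (phi w))).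
have iY : P'.-integrable (psi @^-1` setT) (G \o psi).
  exact: (integrable_bounded P' (measurableT_comp mF mpsi) (fun w => FM (psi w))).
have /= <- := integral_pushforward mphi mG iX measurableT.
have /= <- := integral_pushforward mpsi mG iY measurableT.
pose phi' : {mfun T >-> product_space R I} :=
  HB.pack phi (isMeasurableFun.Build _ _ _ _ phi mphi).
pose psi' : {mfun T' >-> product_space R I} :=
  HB.pack psi (isMeasurableFun.Build _ _ _ _ psi mpsi).
rewrite -[pushforward P _]/(distribution P phi' : set _ -> _).
rewrite -[pushforward P' _]/(distribution P' psi' : set _ -> _).
apply: eq_measure_integral => A mA _.
apply: (@measure_unique _ R (product_space R I) (@cylinders R I) (fun=> setT) _ _ _ _
  (distribution P phi') (distribution P' psi')) => //.
- exact: setI_closed_cylinders.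
- by move=> _; exists (fun=> setT) => //; apply/seteqP; split.
- by apply/seteqP; split => // x _; exists 0%N.
- by move=> _ [B mB <-]; exact: PXY.
- by move=> _; rewrite (le_lt_trans (probability_le1 _ _))// ltry.
Qed.

End CylinderSigmaAlgebra.

(** * Two replicas and the second moment of a conditional mean *)

Section ReplicaSquare.
Variables (R : realType) (d1 d2 : measure_display).
Variables (T1 : measurableType d1) (T2 : measurableType d2).
Variables (P1 : probability T1 R) (P2 : probability T2 R) (f : T1 * T2 -> R).
Hypotheses (mf : measurable_fun setT f) (f1 : forall p, `|f p| <= 1).

Lemma integrable_section (a : T1) :
  P2.-integrable setT (EFin \o (fun y => f (a, y))).
Proof. by apply: (@integrable_bounded _ _ _ P2 _ 1) => //; exact: measurableT_comp. Qed.

Lemma integral_sectionE (a : T1) :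
  (\int[P2]_y (f (a, y))%:E)%E = (\int[P2]_y f (a, y))%:E.
Proof. by rewrite fineK//; apply: integrable_fin_num => //; exact: integrable_section. Qed.

Lemma measurable_Rintegral_section :
  measurable_fun setT (fun a => \int[P2]_y f (a, y)).
Proof.
have mEf : measurable_fun setT (EFin \o f) by exact/measurable_EFinP.
have iEf : (P1 \x P2)%E.-integrable setT (EFin \o f).
  exact: (@integrable_bounded _ _ _ (P1 \x P2)%E _ 1).
by apply: measurableT_comp => //; exact: (@measurable_fubini_F _ _ _ _ R P1 P2 _ iEf).
Qed.

(** By Fubini one may fix [a]; the two remaining variables are independent with law [P2], so the
    integral of the product factors into a square. *)
Lemma replica_square :
  (\int[P1 \x (P2 \x P2)]_q (f (q.1, q.2.1) * f (q.1, q.2.2))%:E =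
   \int[P1]_a ((\int[P2]_y f (a, y)) ^+ 2)%:E)%E.
Proof.
pose Q : probability (T2 * T2)%type R := (P2 \x P2)%E.
pose g (q : T1 * (T2 * T2)) := f (q.1, q.2.1) * f (q.1, q.2.2).
have mg : measurable_fun setT g.
  apply: measurable_funM; apply: (measurableT_comp mf); apply: measurable_fun_pair => //;
  exact: measurableT_comp.
have g1 q : `|g q| <= 1 by rewrite normrM mulr_ile1.
have ig : (P1 \x (P2 \x P2)%E)%E.-integrable setT (EFin \o g).
  exact: (@integrable_bounded _ _ _ (P1 \x (P2 \x P2))%E _ 1).
rewrite -(@integral12_prod_meas1 _ _ _ _ R P1 Q _ ig); apply: eq_integral => a _.
have iga : (P2 \x P2)%E.-integrable setT (EFin \o (fun r => g (a, r))).
  by apply: (@integrable_bounded _ _ _ (P2 \x P2)%E _ 1) => //; exact: measurableT_comp.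
rewrite /fubini_F -[LHS](@integral12_prod_meas1 _ _ _ _ R P2 P2 _ iga) /fubini_F /=.
under eq_integral => y _.
  rewrite /g/=; under eq_integral do rewrite EFinM.
  rewrite integralZl//; last exact: integrable_section.
  rewrite integral_sectionE; over.
rewrite integralZr//; last exact: integrable_section.
by rewrite integral_sectionE -EFinM expr2.
Qed.

End ReplicaSquare.

(** * The disorder, with one coupling redrawn independently *)

Definition perturb (R : realType) (E : Type) (t : R) (j e : E -> R) : E -> R :=
  fun c => j c + t * e c.

Section Resampling.
Variables (R : realType) (E : finType).
Variables (mu nu : probability (measurableTypeR R) R).
Variables (dO : measure_display) (Omega : measurableType dO).
Variables (P : probability Omega R).
Variables (J eps eps' : E -> {RV P >-> measurableTypeR R}).
Hypothesis dis : disorder mu nu J eps eps'.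

Lemma disorder_independent (A B C : E -> set R) :
  (forall e, measurable (A e)) -> (forall e, measurable (B e)) ->
  (forall e, measurable (C e)) ->
  P [set w | forall e, [/\ A e (J e w), B e (eps e w) & C e (eps' e w)]] =
  (\prod_e mu (A e) * \prod_e nu (B e) * \prod_e nu (C e))%E.
Proof.
case: dis => lJ le le' ind mA mB mC.
pose S (i : E + E + E) := match i with
  | inl (inl e) => A e | inl (inr e) => B e | inr e => C e end.
have mS i : measurable (S i) by case: i => [[]|].
have := ind [set: _]%SET S mS; set W := \bigcap_(i in _) _.
have -> : W = [set w | forall e, [/\ A e (J e w), B e (eps e w) & C e (eps' e w)]].
  apply/seteqP; split => [w Ww e|w Ww [[e|e]|e] _]; try by case: (Ww e).
  split.
  - exact: (Ww (inl (inl e)) (finset.in_setT _)).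
  - exact: (Ww (inl (inr e)) (finset.in_setT _)).
  - exact: (Ww (inr e) (finset.in_setT _)).
move=> ->; under eq_bigl do rewrite finset.in_setT.
rewrite big_sumType big_sumType/=; congr (_ * _ * _)%E; apply: eq_bigr => e _.
- exact: (lJ e _ (mA e)).
- exact: (le e _ (mB e)).
- exact: (le' e _ (mC e)).
Qed.

Lemma couplings_independent (A : E -> set R) : (forall e, measurable (A e)) ->
  P [set w | forall e, A e (J e w)] = (\prod_e mu (A e))%E.
Proof.
move=> mA; have := @disorder_independent A (fun=> setT) (fun=> setT) mA.
move=> /(_ (fun=> measurableT) (fun=> measurableT)).
under [X in (_ * X * _)%E]eq_bigr do rewrite probability_setT.
under [X in (_ * X)%E]eq_bigr do rewrite probability_setT.
rewrite !big1_eq !mule1 => <-; congr (P _).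
by apply/seteqP; split => w h e; [split|case: (h e)].
Qed.

Lemma perturbations_independent (B : E -> set R) : (forall e, measurable (B e)) ->
  P [set w | forall e, B e (eps e w)] = (\prod_e nu (B e))%E.
Proof.
move=> mB; have := @disorder_independent (fun=> setT) B (fun=> setT) (fun=> measurableT) mB.
move=> /(_ (fun=> measurableT)).
under [X in (X * _ * _)%E]eq_bigr do rewrite probability_setT.
under [X in (_ * X)%E]eq_bigr do rewrite probability_setT.
rewrite !big1_eq mul1e !mule1 => <-; congr (P _).
by apply/seteqP; split => w h e; [split|case: (h e)].
Qed.

Variables (f : (E -> R) -> R) (b : E) (t : R).
Hypothesis mf : measurable_fun [set: product_space R E] f.
Hypothesis f1 : forall x, `|f x| <= 1.

Lemma measurable_perturb (d : measure_display) (T : measurableType d)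
    (j e : E -> T -> R) :
  (forall c, measurable_fun setT (j c)) -> (forall c, measurable_fun setT (e c)) ->
  measurable_fun setT (fun w => f (perturb t (j^~ w) (e^~ w))).
Proof.
move=> mj me; apply: (measurableT_comp mf); apply: measurable_tofun => c.
by apply: measurable_funD => //; apply: measurable_funM.
Qed.

Let h (q : (Omega * Omega) * Omega) :=
  f (perturb t (update (J^~ q.1.1) b (J b q.1.2)) (eps^~ q.2)).

Let resampled c (p : Omega * Omega) := if c == b then J b p.2 else J c p.1.

Let measurable_resampled_coupling c : measurable_fun setT (resampled c).
Proof. by rewrite /resampled; case: eqP => _; apply: measurableT_comp. Qed.

Lemma measurable_resampled : measurable_fun setT h.
Proof.
apply: (@measurable_perturb _ _ (fun c q => resampled c q.1) (fun c q => eps c q.2)) => c.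
  by apply: measurableT_comp => //; exact: measurable_resampled_coupling.
exact: (measurableT_comp (measurable_funP (eps c)) measurable_snd).
Qed.

(* The coupling at [b] is redrawn from an independent copy [p.2] of the sample
   space, so that it can later be integrated out with everything else fixed. *)
Lemma replica_expectation :
  ('E_P[(fun w => f (perturb t (J^~ w) (eps^~ w)) * f (perturb t (J^~ w) (eps'^~ w)))%R]
   = \int[P \x P]_p
       ((\int[P]_w f (perturb t (update (J^~ p.1) b (J b p.2)) (eps^~ w))) ^+ 2)%:E)%E.
Proof.
pose PP : probability (Omega * Omega)%type R := (P \x P)%E.
pose PPPP : probability _ R := (PP \x PP)%E.
have h1 q : `|h q| <= 1 by exact: f1.
have := replica_square PP P measurable_resampled h1; rewrite {2}/h /= => <-.
(* [X] is the given disorder and [Y] a copy of it on four independent sample spaces: couplings off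
   [b], coupling at [b], first and second perturbation. The second perturbation of [Y] is again
   [eps], which is legitimate since [eps] and [eps'] have the same law. *)
pose X (i : E + E + E) : Omega -> R := match i with
  | inl (inl c) => J c | inl (inr c) => eps c | inr c => eps' c end.
pose Y (i : E + E + E) (q : (Omega * Omega) * (Omega * Omega)) : R := match i with
  | inl (inl c) => resampled c q.1 | inl (inr c) => eps c q.2.1 | inr c => eps c q.2.2 end.
pose F (x : E + E + E -> R) := f (perturb t (x \o inl \o inl) (x \o inl \o inr)) *
  f (perturb t (x \o inl \o inl) (x \o inr)).
rewrite unlock.
apply: (@eq_cylinder_integral R _ _ _ _ _ P PPPP X Y F 1).
- case=> [[c|c]|c] /=.
  + exact: (measurable_funP (J c)).
  + exact: (measurable_funP (eps c)).
  + exact: (measurable_funP (eps' c)).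
- case=> [[c|c]|c] /=.
    exact: (measurableT_comp (measurable_resampled_coupling c) measurable_fst).
    apply: (measurableT_comp (measurable_funP (eps c))).
    exact: (measurableT_comp measurable_fst measurable_snd).
  apply: (measurableT_comp (measurable_funP (eps c))).
  exact: (measurableT_comp measurable_snd measurable_snd).
- move=> B mB.
  have [lJ le le' ind] := dis.
  transitivity (\prod_e mu (B (inl (inl e))) * \prod_e nu (B (inl (inr e))) *
      \prod_e nu (B (inr e)))%E.
    rewrite -disorder_independent//; congr (P _).
    apply/seteqP; split => w Bw => [e|[[e|e]|e]]; try by case: (Bw e).
    by split; [exact: (Bw (inl (inl e)))|exact: (Bw (inl (inr e)))|exact: (Bw (inr e))].
  (* A cylinder event for [Y] is a rectangle over the four spaces; [A1] leaves the coordinate [b]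
     free because [A2] constrains it. *)
  pose A1 := [set w | forall c, (if c == b then setT else B (inl (inl c))) (J c w)].
  pose A2 := J b @^-1` B (inl (inl b)).
  pose A3 := [set w | forall c, B (inl (inr c)) (eps c w)].
  pose A4 := [set w | forall c, B (inr c) (eps c w)].
  have -> : [set q | forall i, B i (Y i q)] = (A1 `*` A2) `*` (A3 `*` A4).
    apply/seteqP; split => [q Bq|q [[B1 B2] [B3 B4]] [[c|c]|c]]; last 2 first.
    - exact: B3.
    - exact: B4.
    - split; split => /=.
      + move=> c; have := Bq (inl (inl c)); rewrite /Y /resampled.
        by case: eqP.
      + by have := Bq (inl (inl b)); rewrite /Y /resampled eqxx.
      + by move=> c; exact: (Bq (inl (inr c))).
      + by move=> c; exact: (Bq (inr c)).
    - rewrite /Y /resampled; case: eqP => [->//|/eqP cb].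
      by have := B1 c; rewrite (negPf cb).
  have mA1 : measurable A1.
    apply: (@measurable_forall R E _ _ (fun c => J c)
      (fun c => if c == b then setT else B (inl (inl c)))) => c.
      exact: (measurable_funP (J c)).
    by case: ifP.
  have mA2 : measurable A2.
    rewrite /A2 -[X in measurable X]setTI.
    exact: (measurable_funP (J b) measurableT _ (mB _)).
  have mA3 : measurable A3.
    by apply: (@measurable_forall R E _ _ (fun c => eps c) (fun c => B (inl (inr c)))) => // c;
      exact: (measurable_funP (eps c)).
  have mA4 : measurable A4.
    by apply: (@measurable_forall R E _ _ (fun c => eps c) (fun c => B (inr c))) => // c;
      exact: (measurable_funP (eps c)).
  transitivity (P A1 * P A2 * (P A3 * P A4))%E; last first.
    rewrite -(product_measure1E P P mA1 mA2) -(product_measure1E P P mA3 mA4).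
    by apply/esym/(product_measure1E PP PP); exact: measurableX.
  pose B1 c := if c == b then setT else B (inl (inl c)).
  have -> : P A1 = (\prod_c mu (B1 c))%E.
    by apply: couplings_independent => c; rewrite /B1; case: ifP.
  have -> : P A3 = (\prod_c nu (B (inl (inr c))))%E.
    exact: (@perturbations_independent (fun c => B (inl (inr c)))).
  have -> : P A4 = (\prod_c nu (B (inr c)))%E.
    exact: (@perturbations_independent (fun c => B (inr c))).
  (* The factor at [b] in the probability of [A1] is 1; the missing factor comes from [A2]. *)
  rewrite (bigD1 b)//= [X in (_ = X * _ * _)%E](bigD1 b)//= {1}/B1 eqxx probability_setT mul1e.
  rewrite muleA; congr (_ * _ * _)%E; rewrite muleC; congr (_ * _)%E.
    by apply: eq_bigr => c /negPf; rewrite /B1 => ->.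
  exact/esym/(lJ b _ (mB _)).
- by apply: measurable_funM; apply: measurable_perturb => c /=;
    exact: (@measurable_coordinate R (E + E + E)%type).
- by move=> x; rewrite normrM mulr_ile1.
Qed.

End Resampling.

(** * Lower bounds for the second moment, uniform in the index set *)

(** Either [g v] is at least [c / 2], or [g u] is below [- c / 2]. By monotonicity the square of [g]
    is then at least [(c / 2) ^+ 2] on the whole half-line above [v] or on the one below [u], and
    each carries mass at least [p]. *)
Lemma square_integral_ge (R : realType) (d : measure_display)
    (T : measurableType d) (P : probability T R) (Z : {RV P >-> measurableTypeR R})
    (g : R -> R) (u v c p : R) :
  {homo g : x y / x <= y} -> 0 <= c -> c <= g v - g u ->
  (p%:E <= P (Z @^-1` `[v, +oo[%classic))%E ->
  (p%:E <= P (Z @^-1` `]-oo, u]%classic))%E ->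
  (((c / 2) ^+ 2 * p)%:E <= \int[P]_w ((g (Z w)) ^+ 2)%:E)%E.
Proof.
move=> ndg c0 cg pv pu.
have mg : measurable_fun setT (fun w => g (Z w)).
  exact: (measurableT_comp (nondecreasing_measurable measurableT ndg) (measurable_funP Z)).
have mZ (B : set (measurableTypeR R)) : measurable B -> measurable (Z @^-1` B).
  by move=> mB; rewrite -[X in measurable X]setTI; exact: (measurable_funP Z measurableT _ mB).
have main (B : set R) : measurable B -> (p%:E <= P (Z @^-1` B))%E ->
    (forall x, B x -> (c / 2) ^+ 2 <= g x ^+ 2) ->
    (((c / 2) ^+ 2 * p)%:E <= \int[P]_w ((g (Z w)) ^+ 2)%:E)%E.
  move=> mB pB gB.
  have mZB : measurable (Z @^-1` B) by exact: mZ.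
  apply: (@le_trans _ _ (\int[P]_w ((c / 2) ^+ 2 * \1_(Z @^-1` B) w)%:E)%E).
    under eq_integral do rewrite EFinM.
    rewrite ge0_integralZl//; last 2 first.
    - by apply/measurable_EFinP; exact: measurable_indic.
    - by rewrite lee_fin sqr_ge0.
    by rewrite integral_indic// setIT EFinM lee_wpmul2l// lee_fin sqr_ge0.
  apply: ge0_le_integral => //.
  - by move=> w _; rewrite lee_fin mulr_ge0 ?sqr_ge0.
  - by apply/measurable_EFinP/measurable_funM => //; exact: measurable_indic.
  - by apply/measurable_EFinP/measurable_funX.
  - move=> w _; rewrite lee_fin indicE.
    by case: (boolP (w \in _)) => [/set_mem/gB|_]; rewrite ?mulr1// mulr0 sqr_ge0.
have [gv|gv] := lerP (c / 2) (g v).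
  apply: (main `[v, +oo[%classic) => // x; rewrite /= in_itv/= andbT => vx.
  by have gx := ndg _ _ vx; rewrite ler_sqr ?nnegrE; lra.
apply: (main `]-oo, u]%classic) => // x; rewrite /= in_itv/= => /ndg gx.
rewrite -[leRHS]sqrrN ler_sqr ?nnegrE; lra.
Qed.

(** Factors outside [D] equal 1, so the bound depends on [m] and not on the size of [E]; this is the
    source of uniformity in the box. *)
Lemma prod_half_le (R : realType) (E : finType) (D : {set E}) (m : nat)
    (rho : probability (measurableTypeR R) R) (B : set R) :
  measurable B -> ((1 / 2)%:E <= rho B)%E -> (#|D| <= m)%N ->
  (((1 / 2) ^+ m)%:E <= \prod_e rho (if e \in D then B else setT))%E.
Proof.
move=> mB rB Dm.
have fB e : rho (if e \in D then B else setT) =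
    (fine (rho (if e \in D then B else setT)))%:E.
  by rewrite fineK// fin_num_measure//; case: ifP.
under eq_bigr do rewrite fB.
rewrite prodEFin lee_fin.
apply: (@le_trans _ _ (\prod_(e : E) if e \in D then 1 / 2 else 1)).
  rewrite -big_mkcond/= prodr_const ler_wiXn2l//; lra.
apply: ler_prod => e _; case: ifP => _; last by rewrite probability_setT/= ler01 lexx.
by rewrite divr_ge0//= -lee_fin fineK// fin_num_measure.
Qed.

Section ReplicaLowerBound.
Variables (R : realType) (E : finType).
Variables (mu nu : probability (measurableTypeR R) R).
Variables (dO : measure_display) (Omega : measurableType dO).
Variables (P : probability Omega R).
Variables (J eps eps' : E -> {RV P >-> measurableTypeR R}).
Hypothesis dis : disorder mu nu J eps eps'.
Variables (f : (E -> R) -> R) (b : E) (t : R).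
Hypothesis mf : measurable_fun [set: product_space R E] f.
Hypothesis f1 : forall x, `|f x| <= 1.

Variables (D : {set E}) (m : nat) (K K' u v c p : R).
Hypothesis Dm : (#|D| <= m)%N.
Hypothesis bD : b \in D.
Hypotheses (c0 : 0 <= c) (uv : u <= v).
Hypothesis f_nondecreasing : forall j x y, x <= y ->
  f (update j b x) <= f (update j b y).
Hypothesis f_gap : forall j s, `|s| <= 1 ->
  (forall e, e \in D -> e != b -> `|j e| <= K + 1) ->
  c <= f (update j b (v + s)) - f (update j b (u + s)).
Hypothesis muK : ((1 / 2)%:E <= mu `[(- K)%R, K]%classic)%E.
Hypothesis nuK' : ((1 / 2)%:E <= nu `[(- K')%R, K']%classic)%E.
Hypothesis tK' : `|t| * K' <= 1.
Hypothesis p0 : 0 <= p.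
Hypothesis muv : (p%:E <= mu `[v, +oo[%classic)%E.
Hypothesis muu : (p%:E <= mu `]-oo, u]%classic)%E.

(** The observable averaged over the perturbation, seen as a function of the coupling at [b] with
    the others frozen at [j]. *)
Let smoothed (j : E -> R) (x : R) : R :=
  \int[P]_w f (perturb t (update j b x) (eps^~ w)).

Lemma perturb_update (j e : E -> R) (x : R) :
  perturb t (update j b x) e = update (perturb t j e) b (x + t * e b).
Proof. by apply/funext => i; rewrite /perturb /update; case: eqP => // ->. Qed.

Let integrable_f (j : E -> R) :
  P.-integrable setT (EFin \o (fun w => f (perturb t j (eps^~ w)))).
Proof.
apply: (@integrable_bounded _ _ _ P _ 1) => //.
apply: (@measurable_perturb R E f t mf _ _ (fun i _ => j i) (fun i => eps i)) => // i.
exact: (measurable_funP (eps i)).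
Qed.

Let smoothed_nondecreasing j : {homo smoothed j : x y / x <= y}.
Proof.
move=> x y xy; apply: le_Rintegral => //= w _.
by rewrite !perturb_update; apply: f_nondecreasing; rewrite lerD2r.
Qed.

Let box_event (X : E -> {RV P >-> measurableTypeR R})
    (k : R) : set Omega :=
  [set w | forall e, (if e \in D then `[- k, k]%classic else setT) (X e w)].

Let measurable_box_event X k : measurable (box_event X k).
Proof.
apply: (@measurable_forall R E _ _ (fun e => X e)
  (fun e => if e \in D then `[- k, k]%classic else setT)) => e.
  exact: (measurable_funP (X e)).
by case: ifP.
Qed.

(** With probability at least [(1 / 2) ^+ m] the perturbations on [D] lie in [[- K', K']].
    Multiplied by [t] they then shift each coupling on [D] by at most 1, which is the room left by
    [s] and [K + 1] in [f_gap]. Outside this event monotonicity still gives a nonnegative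
    difference. *)
Let smoothed_gap j : (forall e, e \in D -> e != b -> `|j e| <= K) ->
  c * (1 / 2) ^+ m <= smoothed j v - smoothed j u.
Proof.
move=> jK; rewrite /smoothed -RintegralB//=.
pose G := box_event eps K'.
have mG : measurable G by exact: measurable_box_event.
have PG : (((1 / 2) ^+ m)%:E <= P G)%E.
  rewrite (perturbations_independent dis
    (B := fun e => if e \in D then `[- K', K']%classic else setT)).
    exact: prod_half_le.
  by move=> e; case: ifP.
have iG : P.-integrable setT (EFin \o (fun w => c * \1_G w)).
  apply: (@integrable_bounded _ _ _ P _ c).
    by apply: measurable_funM => //; exact: measurable_indic.
  move=> w; rewrite normrM ger0_norm// indicE ler_piMr//.
  by case: (_ \in _); rewrite ?normr1 ?normr0.
apply: (@le_trans _ _ (\int[P]_w (c * \1_G w))).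
  rewrite RintegralZl//; last first.
    apply: (@integrable_bounded _ _ _ P _ 1); first exact: measurable_indic.
    by move=> w; rewrite indicE; case: (_ \in _); rewrite ?normr1 ?normr0.
  rewrite ler_wpM2l// /Rintegral integral_indic// setIT.
  by rewrite -lee_fin fineK// fin_num_measure.
apply: le_Rintegral => //=.
  exact: (integrableB measurableT (integrable_f (update j b v)) (integrable_f (update j b u))).
move=> w _; rewrite !perturb_update indicE.
case: (boolP (w \in G)) => [/set_mem Gw|_]; last first.
  by rewrite mulr0 subr_ge0; apply: f_nondecreasing; rewrite lerD2r.
have tw e : e \in D -> `|t * eps e w| <= 1.
  move=> eD; have := Gw e; rewrite eD /= in_itv/= -ler_norml => ew.
  by rewrite normrM; apply: le_trans tK'; rewrite ler_wpM2l.
rewrite mulr1; apply: f_gap; first exact: tw.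
move=> e eD eb; rewrite /perturb; apply: le_trans (ler_normD _ _) _.
by rewrite lerD ?jK ?tw.
Qed.

(** The power of 1/2 inside the square is the probability that the perturbations on [D] are bounded,
    the one outside that the couplings on [D] are; [p] is the mass of the half-line on which the
    redrawn coupling makes the square large. *)
Lemma replica_lower_bound :
  (((c * (1 / 2) ^+ m / 2) ^+ 2 * p * (1 / 2) ^+ m)%:E <=
   'E_P[(fun w => f (perturb t (J^~ w) (eps^~ w)) *
                  f (perturb t (J^~ w) (eps'^~ w)))%R])%E.
Proof.
rewrite (replica_expectation dis b t mf f1).
pose PP : probability (Omega * Omega)%type R := (P \x P)%E.
pose h (q : (Omega * Omega) * Omega) :=
  f (perturb t (update (J^~ q.1.1) b (J b q.1.2)) (eps^~ q.2)).
have mh : measurable_fun setT h.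
  exact: (measurable_resampled J eps b t mf).
have h1 q : `|h q| <= 1 by exact: f1.
pose k (q : Omega * Omega) := ((\int[P]_w h (q, w)) ^+ 2)%:E.
have mk : measurable_fun setT k.
  by apply/measurable_EFinP/measurable_funX; exact: (measurable_Rintegral_section PP P mh h1).
have k0 q : (0 <= k q)%E by rewrite lee_fin sqr_ge0.
(* By Tonelli the couplings off [b] are fixed first, and the inner integral runs over the redrawn
   coupling at [b]. *)
rewrite -[leRHS]/(\int[P \x P]_q k q)%E (fubini_tonelli1 _ mk k0).
pose G := box_event J K.
have mG : measurable G by exact: measurable_box_event.
have PG : (((1 / 2) ^+ m)%:E <= P G)%E.
  rewrite (couplings_independent dis
    (A := fun e => if e \in D then `[- K, K]%classic else setT)).
    exact: prod_half_le.
  by move=> e; case: ifP.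
have m0 : 0 <= (1 / 2 : R) ^+ m by rewrite exprn_ge0.
have A0 : 0 <= (c * (1 / 2) ^+ m / 2) ^+ 2 * p by rewrite mulr_ge0 ?sqr_ge0.
set A := (c * (1 / 2) ^+ m / 2) ^+ 2 * p in A0 *.
apply: (@le_trans _ _ (\int[P]_w (A * \1_G w)%:E)%E).
  under eq_integral do rewrite EFinM.
  rewrite ge0_integralZl//; last first.
    by apply/measurable_EFinP; exact: measurable_indic.
  by rewrite integral_indic// setIT [leLHS]EFinM lee_wpmul2l// lee_fin.
apply: ge0_le_integral => //.
- by move=> w _; rewrite lee_fin mulr_ge0.
- by apply/measurable_EFinP/measurable_funM => //; exact: measurable_indic.
- exact: measurable_fun_fubini_tonelli_F.
move=> w _; rewrite indicE; case: (boolP (w \in G)) => [/set_mem Gw|_]; last first.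
  by rewrite mulr0 integral_ge0.
rewrite mulr1; have [lJ _ _ _] := dis.
apply: (@square_integral_ge _ _ _ P (J b) (smoothed (J^~ w)) u v).
- exact: smoothed_nondecreasing.
- by rewrite mulr_ge0.
- apply: smoothed_gap => e eD _.
  by have := Gw e; rewrite eD /= in_itv/= -ler_norml.
- by apply: (le_trans muv); rewrite -(lJ b).
- by apply: (le_trans muu); rewrite -(lJ b).
Qed.

End ReplicaLowerBound.

(** * Where a law on the line puts its mass *)

Lemma exists_bigcup_gt (R : realType) (d : measure_display) (T : measurableType d)
    (rho : probability T R) (F : (set T)^nat) (a : \bar R) :
  (forall n, measurable (F n)) ->
  (forall n k, (n <= k)%N -> F n `<=` F k) ->
  (a < rho (\bigcup_n F n))%E -> exists n, (a < rho (F n))%E.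
Proof.
move=> mF ndF aF; apply: contrapT => noF.
have cvgF : rho (F n) @[n --> \oo] --> rho (\bigcup_n F n).
  apply: nondecreasing_cvg_mu => //; first exact: bigcup_measurable.
  by move=> n k nk; apply/subsetPset/ndF.
move: aF; rewrite -(cvg_lim _ cvgF)// ltNge => /negP; apply.
apply: lime_le; first by apply/cvg_ex; eexists; exact: cvgF.
by apply: nearW => n; rewrite leNgt; apply/negP => aFn; apply: noF; exists n.
Qed.

Lemma exists_half_mass (R : realType) (rho : probability (measurableTypeR R) R) :
  exists2 K : R, 0 < K & ((1 / 2)%:E <= rho `[(- K)%R, K]%classic)%E.
Proof.
pose F n : set (measurableTypeR R) := `[- n%:R, n%:R]%classic.
have [||//|n Fn] := @exists_bigcup_gt R _ _ rho F (1 / 2)%:E.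
- by move=> n; exact: measurable_itv.
- move=> n k nk x; rewrite /F /= !in_itv/= => /andP[x1 x2].
  have nkR : (n%:R : R) <= k%:R by rewrite ler_nat.
  by apply/andP; split; lra.
- rewrite (_ : \bigcup_n F n = setT) ?probability_setT ?lte_fin; first by lra.
  apply/seteqP; split => // x _; exists (Num.bound `|x|) => //.
  by have := archi_boundP (normr_ge0 x); rewrite /F /= in_itv/= -ler_norml => /ltW.
(* The successor keeps the bound positive when [n] is 0. *)
exists n.+1%:R => //; apply: le_trans (ltW Fn) _.
apply: le_measure; rewrite ?inE; [exact: measurable_itv..|].
move=> x; rewrite /F /= !in_itv/= => /andP[x1 x2].
by rewrite -natr1; apply/andP; split; lra.
Qed.

(* Since [0] is not an atom, mass near [0] must sit on one of its sides, away
   from [0]; the remaining mass near [0] gives the other separated set. *)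
Lemma exists_separated_mass (R : realType) (mu : probability (measurableTypeR R) R) :
  atomless mu -> law_support mu 0 ->
  exists u v p : R, [/\ u < v, 0 < p,
    (p%:E <= mu `[v, +oo[%classic)%E & (p%:E <= mu `]-oo, u]%classic)%E].
Proof.
move=> at0 supp.
have near0 e : 0 < e -> (0 < mu (`](- e)%R, e[%classic : set R))%E.
  move=> e0; apply: supp; first exact: interval_open.
  by rewrite /= in_itv/= oppr_lt0 e0.
have inv_le n k : (n <= k)%N -> (k.+1%:R^-1 : R) <= n.+1%:R^-1.
  by move=> nk; rewrite lef_pV2 ?posrE// ler_nat.
have sep (u v : R) : u < v -> (0 < mu `[v, +oo[%classic)%E ->
    (0 < mu `]-oo, u]%classic)%E -> exists u v p : R, [/\ u < v, 0 < p,
    (p%:E <= mu `[v, +oo[%classic)%E & (p%:E <= mu `]-oo, u]%classic)%E].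
  move=> uv mv mu'.
  have fv : (fine (mu `[v, +oo[%classic))%:E = mu `[v, +oo[%classic.
    by rewrite fineK// fin_num_measure.
  have fu : (fine (mu `]-oo, u]%classic))%:E = mu `]-oo, u]%classic.
    by rewrite fineK// fin_num_measure.
  exists u, v, (Num.min (fine (mu `[v, +oo[%classic)) (fine (mu `]-oo, u]%classic))).
  split => //.
  - by rewrite lt_min -!lte_fin fv fu mv.
  - by rewrite -fv lee_fin ge_min lexx.
  - by rewrite -fu lee_fin ge_min lexx orbT.
have [pos|npos] := ltP 0%E (mu `]0, +oo[%classic).
  have [n|n k nk x||n Fn] := @exists_bigcup_gt R _ _ mu
      (fun n => `[n.+1%:R^-1, +oo[%classic : set (measurableTypeR R)) 0%E.
  - exact: measurable_itv.
  - by rewrite /= !in_itv/= !andbT; apply: le_trans; exact: inv_le.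
  - rewrite (_ : \bigcup_n _ = `]0, +oo[%classic)//.
    apply/seteqP; split => x /=; rewrite in_itv/= andbT => x0.
      by case: x0 => n _; rewrite /= in_itv/= andbT; apply: lt_le_trans.
    have /ltr_add_invr[n] := x0; rewrite add0r => /ltW nx.
    by exists n => //=; rewrite in_itv/= andbT.
  (* The lower half-line contains a neighborhood of 0, which has positive mass because 0 is in the
     support. *)
  apply: (sep (n.+1%:R^-1 / 2) n.+1%:R^-1) => //.
    by rewrite ltr_pdivrMr// ltr_pMr// ltr1n.
  apply: (lt_le_trans (near0 (n.+1%:R^-1 / 2) _)); first by rewrite divr_gt0.
  apply: le_measure; rewrite ?inE; [exact: measurable_itv..|].
  by move=> x /=; rewrite !in_itv/= => /andP[_ /ltW].
(* The interval from -1 to 1 has positive mass, of which none is on the positive side or at 0. The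
   rest is the mirror image of the first case. *)
have neg : (0 < mu `]-oo, 0%R[%classic)%E.
  rewrite ltNge; apply/negP => nneg.
  have := near0 1 ltr01; rewrite ltNge => /negP; apply.
  apply: (@le_trans _ _ (mu (`]-oo, 0%R[ `|` ([set 0] `|` `]0%R, +oo[))%classic)).
    apply: le_measure; rewrite ?inE; [exact: measurable_itv| |].
      by apply: measurableU => //; exact: measurableU.
    move=> x _ /=; rewrite !in_itv/= andbT.
    by case: (ltgtP x 0) => [|?|->]; [left|right; right|right; left].
  have mU : measurable ([set (0 : R)] `|` `]0%R, +oo[ : set (measurableTypeR R)).
    exact: measurableU.
  apply: (le_trans (measureU2 _ _ mU)); first exact: measurable_itv.
  rewrite -[leRHS]adde0; apply: leeD => //.
  apply: (le_trans (measureU2 _ _ _)); [exact: measurable_set1|exact: measurable_itv|].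
  by rewrite [X in (X + _)%E]at0 add0e.
have [n|n k nk x||n Fn] := @exists_bigcup_gt R _ _ mu
    (fun n => `]-oo, - n.+1%:R^-1]%classic : set (measurableTypeR R)) 0%E.
- exact: measurable_itv.
- by rewrite /= !in_itv/= => /le_trans; apply; rewrite lerN2; exact: inv_le.
- rewrite (_ : \bigcup_n _ = `]-oo, 0%R[%classic)//.
  apply/seteqP; split => x /=; rewrite in_itv/= => x0.
    by case: x0 => n _; rewrite /= in_itv/= => /le_lt_trans; apply; rewrite oppr_lt0.
  have : 0 < - x by rewrite oppr_gt0.
  by move/ltr_add_invr => [n]; rewrite add0r => /ltW ?;
    exists n => //=; rewrite in_itv/= lerNr.
apply: (sep (- n.+1%:R^-1) (- (n.+1%:R^-1 / 2))) => //.
  by rewrite ltrN2 ltr_pdivrMr// ltr_pMr// ltr1n.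
apply: (lt_le_trans (near0 (n.+1%:R^-1 / 2) _)); first by rewrite divr_gt0.
apply: le_measure; rewrite ?inE; [exact: measurable_itv..|].
by move=> x /=; rewrite !in_itv/= andbT => /andP[/ltW].
Qed.

(** * Edges and spins of the lattice *)

Section Lattice.
Variables (R : realType) (d : nat).

Lemma neighbors_sym (x y : vertex d) : (y \in neighbors x) = (x \in neighbors y).
Proof.
suff imp (u w : vertex d) : w \in neighbors u -> u \in neighbors w.
  by apply/idP/idP; exact: imp.
rewrite !in_fsetU => /orP[] /imfsetP[i _ ->]; apply/orP; [right|left];
  apply/imfsetP; exists i => //=; first by rewrite addrK.
by rewrite subrK.
Qed.

Lemma card_neighbors (x : vertex d) : (#|` neighbors x| <= 2 * d)%N.
Proof.
rewrite mul2n -addnn cardfsU; apply: leq_trans (leq_subr _ _) _.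
by apply: leq_add; rewrite (leq_trans (leq_imfset_card _ _ _))// size_enum_ord.
Qed.

Lemma edgesP (V : {fset vertex d}) (e : {fset vertex d}) :
  reflect (exists x y, [/\ x \in V, y \in V, y \in neighbors x & e = [fset x; y]%fset])
    (e \in edges V).
Proof.
apply: (iffP idP) => [/imfset2P[x xV [y]]|[x [y [xV yV xy ->]]]].
  by rewrite inE => /andP[yV xy] ->; exists x, y.
by apply/imfset2P; exists x => //; exists y => //; rewrite inE yV.
Qed.

Lemma edges_sub (V W : {fset vertex d}) : (V `<=` W)%fset -> (edges V `<=` edges W)%fset.
Proof.
move=> /fsubsetP VW; apply/fsubsetP => e /edgesP[x [y [xV yV xy ->]]].
by apply/edgesP; exists x, y; split => //; exact: VW.
Qed.

(** An edge at [x] has the form [[fset x; z]] with [z] a neighbor of [x], so the neighbors of [x]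
    enumerate these edges. *)
Lemma card_incident_edges (V : {fset vertex d}) (x : vertex d) :
  (#|[set e : edges V | x \in val e]%SET| <= 2 * d)%N.
Proof.
apply: leq_trans (card_neighbors x); rewrite cardE -(size_map val).
apply: leq_trans (leq_imfset_card imfset_key (fun z => [fset x; z]%fset) (mem (neighbors x))).
apply: uniq_leq_size; first by rewrite (map_inj_uniq val_inj) enum_uniq.
move=> e /mapP[e']; rewrite mem_enum inE => xe ->.
have /edgesP[y [z [_ _ yz ez]]] := valP e'.
rewrite ez in xe *; apply/imfsetP; case/fset2P: xe => ->.
  exists z; [exact: yz|reflexivity].
exists y; last exact: fsetUC.
by rewrite -[y \in _]/(y \in neighbors z) -neighbors_sym.
Qed.

Variable L : {fset vertex d}.
Implicit Types (eta : bcond L) (s : config L) (e : edges (closed_box L)) (x : vertex d).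

Definition edge_spin (eta : bcond L) (e : edges (closed_box L)) (s : config L) : R :=
  \prod_(x <- val e) extend R eta s x.

Definition flip_spin (x : L) (s : config L) : config L :=
  [ffun y => if y == x then ~~ s y else s y].

Lemma flip_spinK (u : L) : involutive (flip_spin u).
Proof.
by move=> s; apply/ffunP => y; rewrite !ffunE; case: eqP; rewrite ?negbK.
Qed.

Lemma normr_spin c : `|spin R c| = 1.
Proof. by case: c; rewrite /spin ?normrN normr1. Qed.

Lemma normr_extend eta s x : `|extend R eta s x| = 1.
Proof.
by rewrite /extend; case: insub => [?|]; [exact: normr_spin|case: insub => [?|];
  [exact: normr_spin|exact: normr1]].
Qed.

Lemma extend_in eta s (u : L) : extend R eta s (val u) = spin R (s u).
Proof. by rewrite /extend valK. Qed.

Lemma extend_flip eta s (u : L) x :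
  extend R eta (flip_spin u s) x = (if x == val u then -1 else 1) * extend R eta s x.
Proof.
rewrite /extend; case: insubP => [w _ wx|xL].
  rewrite ffunE -wx (inj_eq val_inj); case: eqP => _; rewrite ?mul1r//.
  by rewrite /spin; case: (s w); rewrite ?mulrNN ?mulr1.
rewrite (_ : x == val u = false) ?mul1r//.
by apply: contraNF xL => /eqP ->; exact: valP.
Qed.

(** A vertex occurs at most once in an edge, so flipping it changes the sign of exactly one factor.
    This provides [chi_flip], with [D] the set of edges at [u]. *)
Lemma edge_spin_flip eta e (u : L) s :
  edge_spin eta e (flip_spin u s) =
  if e \in [set e : edges (closed_box L) | val u \in val e]%SET
  then - edge_spin eta e s else edge_spin eta e s.
Proof.
rewrite inE /edge_spin; under eq_bigr do rewrite extend_flip.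
rewrite big_split/=; case: ifPn => ue.
  rewrite (big_fsetD1 (val u))//= eqxx big_seq big1 ?mulr1 ?mulN1r// => i.
  by rewrite !inE => /andP[/negPf ->].
rewrite big_seq big1 ?mul1r// => i ie; case: eqP => // iu.
by move: ue; rewrite -iu ie.
Qed.

Lemma normr_edge_spin eta e s : `|edge_spin eta e s| = 1.
Proof. by rewrite normr_prod big1// => i _; exact: normr_extend. Qed.

Lemma edge_spin_pm1 eta e s : (edge_spin eta e s == 1) || (edge_spin eta e s == -1).
Proof. by have /eqP := normr_edge_spin eta e s; rewrite eqr_norml ler01 andbT. Qed.

(** Reconciles the products in the overlap, taken over vertices of the box, with those in the
    Hamiltonian, which also see the boundary condition. *)
Lemma edge_spinE eta (e : edges (closed_box L)) s : (val e `<=` L)%fset ->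
  \prod_(x : L | val x \in val e) spin R (s x) = edge_spin eta e s.
Proof.
move=> /fsubsetP eL.
under eq_bigr do rewrite -(extend_in eta).
rewrite -(big_seq_fsetE _ L (fun x => x \in val e) (extend R eta s)) big_fset_condE.
rewrite /edge_spin; congr (\big[_/_]_(_ <- _) _).
congr enum_fset; apply/fsetP => x; rewrite !inE/=.
by case: (boolP (x \in val e)) => [/eL ->|]; rewrite ?andbF.
Qed.

Lemma gibbs_weight beta eta (J : couplings R L) s :
  gibbs beta eta J s =
  weight beta (edge_spin eta) J s / \sum_s weight beta (edge_spin eta) J s.
Proof.
have wE s' : expR (- beta * hamiltonian eta J s') = weight beta (edge_spin eta) J s'.
  congr expR; rewrite /hamiltonian mulNr -mulrN -sumrN; congr (_ * _).
  by apply: eq_bigr => e _; rewrite mulNr opprK.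
by rewrite /gibbs /partition_function wE; under eq_bigr do rewrite wE.
Qed.

(** For fixed couplings the replicas are independent, so for each edge the double sum factors into
    two Gibbs means. *)
Lemma mean_overlapE beta eta (J J' : couplings R L) :
  mean_overlap beta eta J J' =
  (#|` edges L|%:R)^-1 * \sum_(b <- edges L)
    (mean beta (edge_spin eta) J (fun s => \prod_(x : L | val x \in b) spin R (s x)) *
     mean beta (edge_spin eta) J' (fun s => \prod_(x : L | val x \in b) spin R (s x))).
Proof.
rewrite /mean_overlap /mean.
under eq_bigr do under eq_bigr do rewrite !gibbs_weight /overlap.
set Z := \sum_s weight _ _ J s; set Z' := \sum_s weight _ _ J' s.
transitivity (\sum_(s : config L) \sum_(s' : config L) \sum_(b <- edges L)
   (#|` edges L|%:R)^-1 *
   ((\prod_(x : L | val x \in b) spin R (s x) * weight beta (edge_spin eta) J s / Z) *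
    (\prod_(x : L | val x \in b) spin R (s' x) * weight beta (edge_spin eta) J' s' / Z'))).
  apply: eq_bigr => s _; apply: eq_bigr => s' _.
  rewrite !mulr_sumr; apply: eq_bigr => b _; rewrite big_split/=; ring.
under eq_bigr do rewrite exchange_big; rewrite exchange_big/= mulr_sumr.
apply: eq_bigr => b _; rewrite !mulr_suml mulr_sumr.
apply: eq_bigr => s _.
by rewrite !mulr_sumr.
Qed.

End Lattice.

(** * From single edges to the averaged overlap *)

Lemma measurable_mean (R : realType) (S E : finType) (beta : R)
    (chi : E -> S -> R) (g : S -> R) :
  measurable_fun [set: product_space R E] (fun J => mean beta chi J g).
Proof.
have mW s : measurable_fun [set: product_space R E] (fun J => weight beta chi J s).
  apply: measurableT_comp => //; apply: measurable_funM => //.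
  apply: measurable_sum => e; apply: measurable_funM => //.
  exact: measurable_coordinate.
case: (pickP [pred s : S | true]) => [s0 _|S0]; last first.
  rewrite [X in measurable_fun _ X](_ : _ = cst 0)//.
  by apply/funext => J; rewrite /mean big_pred0 ?mul0r// => s; move: (S0 s).
(* The partition function is positive, so its inverse is the exponential of minus its logarithm, a
   composition of measurable functions. *)
rewrite [X in measurable_fun _ X](_ : _ = (fun J => (\sum_s g s * weight beta chi J s) *
    expR (- ln (\sum_s weight beta chi J s)))); last first.
  apply/funext => J; rewrite /mean expRN lnK// posrE.
  exact: sum_weight_gt0 J s0.
apply: measurable_funM.
  by apply: measurable_sum => s; apply: measurable_funM => //; exact: mW.
apply: measurableT_comp => //; apply: measurableT_comp => //; apply: measurableT_comp => //.
by apply: measurable_sum => s; exact: mW.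
Qed.

(** The corner of the box and its successor in the first direction form an edge, so the
    normalization of the overlap is not a division by 0. *)
Lemma edges_box_gt0 (d n : nat) (a : vertex d) : (1 <= d)%N -> (2 <= n)%N ->
  (0 < #|` edges (box a n)|)%N.
Proof.
move=> d1 n2; pose i0 : 'I_d := Ordinal d1.
have n0 : (0 < n)%N by exact: leq_trans n2.
pose k0 : {ffun 'I_d -> 'I_n} := [ffun=> Ordinal n0].
pose k1 : {ffun 'I_d -> 'I_n} := [ffun i => if i == i0 then Ordinal n2 else Ordinal n0].
rewrite cardfs_gt0; apply/fset0Pn; exists [fset box_point a k0; box_point a k1]%fset.
apply/edgesP; exists (box_point a k0), (box_point a k1); split => //.
- by apply/imfsetP; exists k0.
- by apply/imfsetP; exists k1.
- rewrite in_fsetU; apply/orP; left; apply/imfsetP; exists i0 => //.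
  apply/rowP => i; rewrite !mxE !ffunE eqxx/= -addrA; congr (_ + _).
  by case: eqP.
Qed.

Lemma expectation_scaled_sum (R : realType) (d : measure_display)
    (T : measurableType d) (P : probability T R) (I : Type) (r : seq I)
    (k : R) (Y : I -> T -> R) :
  (forall i, P.-integrable setT (EFin \o Y i)) ->
  ('E_P[(fun w => k * \sum_(i <- r) Y i w)%R] = k%:E * \sum_(i <- r) 'E_P[Y i])%E.
Proof.
move=> iY; rewrite expectation.unlock.
have iS : P.-integrable setT (fun w => (\sum_(i <- r) (EFin \o Y i) w)%E).
  exact: integrable_sum.
transitivity (\int[P]_w (k%:E * \sum_(i <- r) (EFin \o Y i) w))%E.
  by apply: eq_integral => w _ /=; rewrite EFinM -sumEFin.
by rewrite integralZl// integral_sum.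
Qed.

Theorem theorem1p3 (R : realType) (d : nat) (hd : (1 <= d)%N)
    (beta : R) (hbeta : 0 < beta)
    (mu : probability (measurableTypeR R) R)
    (hmu : atomless mu) (hmu0 : law_support mu 0) :
  exists2 delta' : R, 0 < delta' &
  forall nu : probability (measurableTypeR R) R,
  atomless nu -> centered nu ->
  exists (c : R) (t0 : R -> R),
  [/\ 0 < c, forall delta : R, 0 < delta -> 0 < t0 delta &
  forall (a : vertex d) (n : nat), (2 <= n)%N ->
  let L := box a n in
  forall (eta : bcond L)
    (dO : measure_display) (Omega : measurableType dO)
    (P : probability Omega R)
    (J eps eps' : edges (closed_box L) -> {RV P >-> measurableTypeR R}),
  disorder mu nu J eps eps' ->
  exists A : set Omega,
  [/\ measurable A, (c%:E <= P A)%E &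
  forall delta : R, 0 < delta ->
  forall t : R, 0 <= t < t0 delta ->
  (((1 - delta) * delta')%:E * P A <
   'E_P[fun w => mean_overlap beta eta
                   (fun b => (J b w + t * eps b w)%R)
                   (fun b => (J b w + t * eps' b w)%R)])%E]].
Proof.
have [u [v [p [uv p0 pv pu]]]] := exists_separated_mass hmu hmu0.
have [K0 K00 muK0] := exists_half_mass mu.
(* Enlarging [K0] keeps half of the mass and puts [u] and [v] in [[- K, K]], so that shifted by at
   most 1 they stay within [K + 1]. *)
pose K := K0 + `|u| + `|v|.
have u0 := normr_ge0 u; have v0 := normr_ge0 v.
have muK : ((1 / 2)%:E <= mu `[(- K)%R, K]%classic)%E.
  apply: (le_trans muK0); apply: le_measure; rewrite ?inE; [exact: measurable_itv..|].
  by move=> x; rewrite /= !in_itv/= => /andP[? ?]; rewrite /K; apply/andP; split; lra.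
pose m := (2 * d)%N.
pose gap := mean_gap beta m (K + 1) (v - u).
have gap0 : 0 < gap by apply: mean_gap_gt0; rewrite ?subr_gt0.
(* This is the bound of [replica_lower_bound]. It involves only [mu], [beta] and [d]; the law [nu]
   enters through [K'] alone, and hence only in the range of [t]. *)
pose kappa := (gap * (1 / 2) ^+ m / 2) ^+ 2 * p * (1 / 2) ^+ m.
have half0 : 0 < (1 / 2 : R) ^+ m by rewrite exprn_gt0// divr_gt0.
have kappa0 : 0 < kappa.
  by rewrite /kappa mulr_gt0// mulr_gt0// exprn_gt0// divr_gt0// mulr_gt0.
exists kappa => // nu _ _.
have [K' K'0 nuK'] := exists_half_mass nu.
(* The event is the whole space, so [c] is 1; [t < K'^-1] ensures [t * K' <= 1], for every [delta]
   alike. *)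
exists 1, (fun=> K'^-1); split => // [delta _|a n n2 L eta dO Omega P J eps eps' dis].
  by rewrite invr_gt0.
exists setT; split => //; first by rewrite probability_setT.
move=> delta delta0 t /andP[t0 tK].
have tK' : `|t| * K' <= 1 by rewrite ger0_norm// -ler_pdivlMr// div1r ltW.
(* The strict inequality comes from [1 - delta < 1]; it remains to bound the expectation below by
   [kappa]. *)
rewrite probability_setT mule1; apply: (@lt_le_trans _ _ kappa%:E).
  by rewrite lte_fin gtr_pMl// ltrBlDr ltrDl.
pose X (b : {fset vertex d}) (j : edges (closed_box L) -> R) :=
  mean beta (edge_spin R eta) j (fun s => \prod_(x : L | val x \in b) spin R (s x)).
have X1 b j : `|X b j| <= 1.
  apply: mean_normr_le1 => s; rewrite normr_prod big1// => x _; exact: normr_spin.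
have edge_bound b : b \in edges L -> (kappa%:E <=
   'E_P[(fun w => X b (perturb t (J^~ w) (eps^~ w)) *
                  X b (perturb t (J^~ w) (eps'^~ w)))%R])%E.
  move=> bL.
  have bC : b \in edges (closed_box L).
    by apply: (fsubsetP (edges_sub _)) bL; exact: fsubsetUl.
  pose b' : edges (closed_box L) := [` bC]%fset.
  have [x [y [xL yL _ bxy]]] := edgesP _ _ bL.
  have bsub : (val b' `<=` L)%fset.
    by rewrite /= bxy; apply/fsubsetP => z /fset2P[]->.
  have XE j : X b j = mean beta (edge_spin R eta) j (edge_spin R eta b').
    by congr mean; apply/funext => s; rewrite -edge_spinE.
  (* The vertex to flip is an endpoint of [b]; it lies in the box, where spins are free. *)
  pose x' : L := [` xL]%fset.
  pose D := [set e : edges (closed_box L) | val x' \in val e]%SET.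
  have bD : b' \in D by rewrite inE /= bxy fset21.
  have Dm : (#|D| <= m)%N by exact: card_incident_edges.
  have s0 : config L := [ffun=> true].
  apply: (@replica_lower_bound R _ mu nu dO Omega P J eps eps' dis (X b) b' t
    _ _ D m K K' u v gap p) => //.
  - exact: measurable_mean.
  - exact: ltW.
  - exact: ltW.
  - move=> j r r' rr'; rewrite !XE.
    apply: (@mean_update_le _ _ _ _ _ _ (@edge_spin_pm1 _ _ _ eta b') (flip_spin x') D) => //.
    + by move=> e s; exact: edge_spin_flip.
    + exact: ltW.
  - move=> j r r1 jK; rewrite !XE /gap (_ : v - u = (v + r) - (u + r)); last by ring.
    apply: (@mean_update_gap _ _ _ _ _ _ (@edge_spin_pm1 _ _ _ eta b') (flip_spin x') D
      (flip_spinK x') _ bD _ m Dm) => //.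
    + by move=> e s; exact: edge_spin_flip.
    + by move=> e s; rewrite normr_edge_spin.
    + exact: ltW.
    + by rewrite /K; lra.
    + by rewrite lerD2r ltW.
    + apply: le_trans (ler_normD _ _) _; rewrite /K; lra.
    + apply: le_trans (ler_normD _ _) _; rewrite /K; lra.
  - exact: ltW.
have mX b (e : edges (closed_box L) -> {RV P >-> measurableTypeR R}) :
    measurable_fun setT (fun w => X b (perturb t (J^~ w) (e^~ w))).
  apply: (@measurable_perturb R _ (X b) t (measurable_mean _ _ _) _ _ J e) => c.
    exact: (measurable_funP (J c)).
  exact: (measurable_funP (e c)).
pose Y b w := X b (perturb t (J^~ w) (eps^~ w)) * X b (perturb t (J^~ w) (eps'^~ w)).
have iY b : P.-integrable setT (EFin \o Y b).
  apply: (@integrable_bounded _ _ _ P _ 1) => [|w]; first exact: measurable_funM.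
  by rewrite normrM mulr_ile1.
have N0 := edges_box_gt0 a hd n2.
have -> : (fun w => mean_overlap beta eta (fun b => (J b w + t * eps b w)%R)
      (fun b => (J b w + t * eps' b w)%R)) =
    (fun w => (#|` edges L|%:R)^-1 * \sum_(b <- edges L) Y b w).
  by apply/funext => w; rewrite mean_overlapE.
rewrite expectation_scaled_sum//.
(* The overlap is an average over edges, so a bound by [kappa] for each edge passes to the
   average. *)
apply: (@le_trans _ _ ((#|` edges L|%:R)^-1%:E * \sum_(b <- edges L) kappa%:E)%E).
  rewrite sumEFin -EFinM lee_fin big_const_seq count_predT iter_addr addr0.
  by rewrite -[kappa *+ _]mulr_natl mulKf// pnatr_eq0 -lt0n.
rewrite lee_wpmul2l ?lee_fin ?invr_ge0//.
by rewrite big_seq [leRHS]big_seq; apply: lee_sum => b; exact: edge_bound.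
Qed.
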